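(* Let $n\ge3$ and $r\ge1$ be integers. The number of nonzero eigenvalues of $A_{n,r}$ (counted with algebraic multiplicity) is $$\deg\Phi_{n,r}-\mathrm{ord}_x\Phi_{n,r}=n\Bigl\lfloor\frac{r+2}{3}\Bigr\rfloor.$$
   Context: For integers $n\ge3$ and $r\ge1$, the digraph $\Gamma_{n,r}$ has vertex set $V(\Gamma_{n,r})=\{1,2,\dots,rn-2r+2\}$ and directed edge set $E(\Gamma_{n,r})$ defined by $E(\Gamma_{n,1})=\{(j,j+1):1\le j\le n-1\}\cup\{(n,1)\}$; $E(\Gamma_{n,2})=E(\Gamma_{n,1})\cup\{(1,n+1)\}\cup\{(j,j+1):n+1\le j\le 2n-3\}\cup\{(2n-2,n)\}$; and for $r\ge3$, $E(\Gamma_{n,r})=E(\Gamma_{n,2})\cup\bigcup_{i=1}^{r-2}F_i$, where $F_i=\{(in-2i+2,\,in+n-2i+1)\}\cup\{(j,j+1):in+n-2i+1\le j\le in+2n-2i-3\}\cup\{(in+2n-2i-2,\,in+n-2i)\}$. (For $n=3$ the middle path parts are empty.) The adjacency matrix $A_{n,r}$ is the $(0,1)$-matrix indexed by $V(\Gamma_{n,r})$ whose $(u,v)$-entry is $1$ if and only if $(u,v)\in E(\Gamma_{n,r})$, and $\Phi_{n,r}=\det(xI-A_{n,r})\in\mathbb Z[x]$. For $\Phi\in\mathbb Z[x]$, $\mathrm{ord}_x\Phi$ denotes the order of vanishing of $\Phi$ at $x=0$. *)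

(* Defs.v *)
From HB Require Import structures.
From mathcomp Require Import all_boot all_order all_algebra all_field.

Set Implicit Arguments.
Unset Strict Implicit.
Unset Printing Implicit Defensive.

Import GRing.Theory.

Local Open Scope nat_scope.

(* Edges are given on the 1-based vertex labels 1, ..., r n - 2 r + 2.  For
   n >= 3 none of the truncated subtractions below is ever cut off at 0. *)
Definition edges1 (n : nat) : rel nat := fun u v =>
  [|| (1 <= u <= n - 1) && (v == u + 1)
    | (u == n) && (v == 1)].

Definition edges2 (n : nat) : rel nat := fun u v =>
  [|| edges1 n u v,
      (u == 1) && (v == n + 1),
      (n + 1 <= u <= 2 * n - 3) && (v == u + 1)
    | (u == 2 * n - 2) && (v == n)].

Definition edgesF (n i : nat) : rel nat := fun u v =>
  [|| (u == i * n - 2 * i + 2) && (v == i * n + n - 2 * i + 1),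
      (i * n + n - 2 * i + 1 <= u <= i * n + 2 * n - 2 * i - 3) && (v == u + 1)
    | (u == i * n + 2 * n - 2 * i - 2) && (v == i * n + n - 2 * i)].

(* The value at r = 0 is a dummy. *)
Definition Gamma_edge (n r : nat) : rel nat := fun u v =>
  match r with
  | 0 | 1 => edges1 n u v
  | 2 => edges2 n u v
  | _ => edges2 n u v || has (fun i => edgesF n i u v) (iota 1 (r - 2))
  end.

Definition Gamma_order (n r : nat) : nat := r * n - 2 * r + 2.

Local Open Scope ring_scope.

(* The ordinal u : 'I_N stands for the vertex labelled u + 1. *)
Definition adjacency (n r : nat) : 'M[int]_(Gamma_order n r) :=
  \matrix_(u, v) (Gamma_edge n r u.+1 v.+1)%:R.

Definition Phi (n r : nat) : {poly int} := char_poly (adjacency n r).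

Definition deg (p : {poly int}) : nat := (size p).-1.

(* mup is only available over a field, hence the embedding of Z[x] in Q[x]. *)
Definition ordx (p : {poly int}) : nat :=
  mup 0 (map_poly (intr : int -> rat) p).

(* The eigenvalues listed with algebraic multiplicity: the roots, with
   multiplicity, of the (monic) characteristic polynomial. *)
Definition eigenvalues (N : nat) (A : 'M[algC]_N) : seq algC :=
  sval (closed_field_poly_normal (char_poly A)).

Definition num_nonzero_eigenvalues (N : nat) (A : 'M[int]_N) : nat :=
  count (fun z : algC => z != 0)
    (eigenvalues (map_mx (intr : int -> algC) A)).

(* Main.v *)
Require Import Defs.
From mathcomp Require Import all_boot all_order all_algebra all_field.
From mathcomp Require Import perm zify ring.

(** Put h = n - 2 and count vertices from 0.  The digraph is a chain of r
    directed n-cycles, numbered 0, ..., r - 1, along which run special vertices,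
    the corners 0, ..., r + 1.  Cycle c leaves corner c, runs through h new
    vertices, the last of which is corner c + 2, and comes back through corner
    c + 1; every vertex with two incoming or two outgoing edges is a corner.  At
    the level of corners every step is thus +2 or -1, so that the only simple
    cycles are the r cycles of the chain, and two of them are disjoint exactly
    when their indices differ by at least 3.  Expanding the determinant over
    disjoint unions of cycles, the characteristic polynomial is the sum over j of
    (-1)^j N_j x^(rh + 2 - nj), where N_j counts the j-subsets of {1, ..., r}
    with gaps at least 3.  The largest possible j is floor((r + 2) / 3), hence
    the lowest exponent.

    The formal proof replaces the expansion by the recursion that it satisfies
    ([chain_polyS]), namely
      D(r+3) = x^h D(r+2) - x^(2h-2) D(r),
    and gets this recursion by elimination.  Every vertex but the first two is
    entered by exactly one edge that goes up the chain.  Ordering the rows of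
    x - A by these edges gives a matrix whose lower right block is triangular
    with -1 on the diagonal ([det_drsubmx_char_mx_rows]).  In other words, a
    vector v with (x - A) v = 0 in all the corresponding rows is determined by
    its first two coordinates, and only two equations remain
    ([char_entry_vertex_val]).  Their 2 x 2 determinant is, up to sign, the
    characteristic polynomial ([det_char_mx_rows]).  The entries of this
    determinant obey a linear recursion of order three, so its value obeys one
    too ([det_corner_residues]).

    Reading the recursion modulo 3 ([chain_poly_factor]), D(r) is a power of x
    times a polynomial whose constant term has a sign depending only on
    floor((r + 2) / 3): in the recursion, terms of equal exponent always have
    equal signs.  This gives the multiplicity of the root 0, in Q[x] as well as
    over the algebraic numbers. *)

Set Implicit Arguments.
Unset Strict Implicit.
Unset Printing Implicit Defensive.

Import Order.TTheory GRing.Theory Num.Theory.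

Local Open Scope nat_scope.

(** * The edges of the chain of cycles *)

(** Only the first two corners escape the general formula: the vertices 1 and 0
    form the outer edge of the first cycle, traversed from 0 to 1. *)
Definition corner (h k : nat) : nat :=
  match k with 0 => 1 | 1 => 0 | k'.+2 => (k'.+1 * h).+1 end.

(** The edges that cycle c adds to the previous ones; the remaining edge of
    this cycle, from corner c + 1 to corner c, is the last one added by cycle
    c - 1, or the outer edge from vertex 0 to vertex 1 when c = 0. *)
Definition cycle_edge (h c : nat) : rel nat := fun u v =>
  [|| (u == corner h c) && (v == 2 + c * h),
      (2 + c * h <= u < 1 + c * h + h) && (v == u.+1)
    | (u == corner h c.+2) && (v == corner h c.+1)].

Lemma edges1E h u v : 0 < h ->
  edges1 h.+2 u.+1 v.+1 =
  (u == corner h 1) && (v == corner h 0) || cycle_edge h 0 u v.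
Proof. by move=> h0; rewrite /edges1 /cycle_edge /=; lia. Qed.

Lemma edges2E h u v : 0 < h ->
  edges2 h.+2 u.+1 v.+1 = edges1 h.+2 u.+1 v.+1 || cycle_edge h 1 u v.
Proof. by move=> h0; rewrite /edges2 /cycle_edge /=; lia. Qed.

Lemma edgesFE h i u v : 0 < h -> 0 < i ->
  edgesF h.+2 i u.+1 v.+1 = cycle_edge h i.+1 u v.
Proof.
case: i => [//|i] h0 _; rewrite /edgesF /cycle_edge /= !mulSn !mulnS.
by move: (i * h) (i * 2) (2 * i) => a b c; lia.
Qed.

Lemma Gamma_edgeE h r u v : 0 < h -> 0 < r ->
  Gamma_edge h.+2 r u.+1 v.+1 =
  (u == corner h 1) && (v == corner h 0)
  || has (fun c => cycle_edge h c u v) (iota 0 r).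
Proof.
move=> h0; case: r => [//|[|[|r]]] _; rewrite /Gamma_edge.
- by rewrite edges1E //= orbF.
- by rewrite edges2E // edges1E //= orbF -orbA.
have -> : iota 0 r.+3 = [:: 0, 1 & [seq i.+1 | i <- iota 1 (r.+3 - 2)]].
  by rewrite -(iotaDl 1).
have := mem_iota 1 (r.+3 - 2); move: (iota 1 _) => s sE.
rewrite edges2E // edges1E // [RHS]/= has_map.
rewrite !orbA; congr (_ || _).
apply: eq_in_has => i; rewrite sE => /andP[i0 _] /=.
by rewrite edgesFE.
Qed.

(** For i >= 2, the vertex from which the unique upward edge enters i.  The
    last two corners are the only vertices without an upward edge; giving them
    the indices 0 and 1 makes this map a permutation of the vertices. *)
Definition row_source (h r i : nat) : nat :=
  match i with
  | 0 => corner h r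
  | 1 => corner h r.+1
  | t.+2 => if h %| t then corner h (t %/ h) else t.+1
  end.

(** The edges going down the chain, from each corner to the previous one. *)
Definition descent (h r : nat) : rel nat := fun u v =>
  has (fun k => (u == corner h k.+1) && (v == corner h k)) (iota 0 r.+1).

Lemma corner_inj h : 0 < h -> injective (corner h).
Proof.
by move=> h0 [|[|k]] [|[|l]] //=; nia.
Qed.

Lemma descent_corner h r k v : 0 < h -> k <= r ->
  descent h r (corner h k.+1) v = (v == corner h k).
Proof.
move=> h0 kr; apply/hasP/idP => [[l _ /andP[/eqP]]|vk].
  by move=> /(corner_inj h0) [->].
by exists k; rewrite ?mem_iota //= eqxx.
Qed.

Lemma descent_corner0 h r v : 0 < h -> descent h r (corner h 0) v = false.
Proof.
move=> h0; apply/hasP => -[l _ /andP[/eqP]].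
by move=> /(corner_inj h0).
Qed.

(** A vertex 1 + t with t not divisible by h lies strictly inside a path between
    two corners. *)
Lemma corner_interior h k t : ~~ (h %| t) -> t.+1 != corner h k.
Proof.
case: k => [|[|k]] //= ht; last first.
  by apply: contra ht; rewrite eqSS => /eqP->; rewrite dvdn_mull.
by case: t ht; rewrite ?dvdn0.
Qed.

Lemma descent_interior h r t v : ~~ (h %| t) -> descent h r t.+1 v = false.
Proof.
move=> ht; apply/hasP => -[l _ /andP[]].
by rewrite (negPf (corner_interior _ ht)).
Qed.

(** Since a vertex v >= 2 has a single upward edge, matching a row index with
    row_source turns the upward part of the adjacency matrix into a partial
    identity matrix. *)
Lemma Gamma_edge_split h r u v : 0 < h -> 0 < r -> v < 2 + r * h ->
  Gamma_edge h.+2 r u.+1 v.+1 =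
  (1 < v) && (u == row_source h r v) || descent h r u v.
Proof.
move=> h0 r0 vN; rewrite Gamma_edgeE //; apply/idP/idP.
  case/orP => [uv|/hasP[c]].
    by apply/orP; right; apply/hasP; exists 0; rewrite // mem_iota.
  rewrite mem_iota => /= cr /or3P[|| uv].
  - case/andP => /eqP-> /eqP->; apply/orP; left => /=.
    by rewrite dvdn_mull // mulnK.
  - case/andP => /andP[cu uc] /eqP->; apply/orP; left.
    have [t tE]: exists t, u = (c * h + t).+2 by exists (u - (c * h).+2); lia.
    rewrite tE /=; have th : t.+1 < h by lia.
    by rewrite -addnS /dvdn modnMDl modn_small //= addnS.
  - apply/orP; right; apply/hasP; exists c.+1 => //.
    by rewrite mem_iota; lia.
case/orP => [/andP[]|/hasP[[|k]]]; last 2 first.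
- by move=> _ uv; apply/orP; left.
- rewrite mem_iota => kr uv; apply/orP; right; apply/hasP; exists k.
    by rewrite mem_iota; lia.
  by rewrite /cycle_edge uv !orbT.
case: v vN => [|[|t]] //= tN _ ut; apply/orP; right.
have tr : t %/ h < r by rewrite ltn_divLR //; lia.
apply/hasP; exists (t %/ h); first by rewrite mem_iota.
rewrite /cycle_edge; case: ifPn ut => [/divnK tE|ht] /eqP->.
  by rewrite eqxx tE eqxx.
have := ltn_pmod t h0; have := divn_eq t h; move: ht; rewrite /dvdn.
by move: (t %/ h * h) (corner h (t %/ h).+2) => a b tE mh; lia.
Qed.

Lemma row_source_inj h r : 0 < h ->
  {in gtn (2 + r * h) &, injective (row_source h r)}.
Proof.
move=> h0.
have cE k l : corner h k = corner h l -> k = l by exact: corner_inj.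
have cI k t : ~~ (h %| t) -> corner h k = t.+1 -> False.
  by move=> /(corner_interior k)/eqP + /esym.
move=> i j; rewrite !inE; case: i => [|[|i]] Hi; case: j => [|[|j]] Hj;
  rewrite /row_source; try case: ifPn => hi; try case: ifPn => hj //.
all: try by move=> /cE; lia.
all: try by move=> /cI; case.
all: try by move=> /esym/cI; case.
all: try by move=> [->].
Qed.

Lemma ascent_not_descent h r u v : 0 < h ->
  (1 < v) && (u == row_source h r v) && descent h r u v = false.
Proof.
move=> h0; apply/negP => /andP[/andP[v1 /eqP uE]].
case/hasP => k _ /andP[/eqP uk /eqP vk].
move: uE; rewrite {}uk {u}; case: v v1 vk => [|[|t]] // _; rewrite /row_source.
case: k => [|[|k]] // [tk]; case: ifPn => [/divnK tE /(corner_inj h0)|_ [] tE].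
  by nia.
by nia.
Qed.

Local Open Scope ring_scope.

(** * Elimination of all but two coordinates *)

Lemma det_mx2 (R : comNzRingType) (A : 'M[R]_2) :
  \det A = A 0 0 * A 1 1 - A 0 1 * A 1 0.
Proof.
rewrite (expand_det_row _ 0) !big_ord_recl big_ord0 addr0 /cofactor !det_mx11.
rewrite !mxE expr0 expr1 mul1r mulN1r mulrN.
by congr (_ * A _ _ - A _ _ * A _ _); apply: val_inj.
Qed.

Section Elimination.
Variables (R : comNzRingType) (x : R) (h : nat).
Hypothesis h_gt0 : (0 < h)%N.

(** Carrying three consecutive terms of [corner_val] turns its recursion of
    order three into one of order one. *)
Fixpoint corner_state (a b : R) (k : nat) : R * R * R :=
  if k is k'.+1 then
    let: (u, v, w) := corner_state a b k' in (v, w, x ^+ h.-1 * (x * v - u))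
  else (0, a, b).

(** With v_0 = b and v_1 = a, the vector v solving all the equations
    (x - A) v = 0 attached to upward edges has value corner_val a b k.+1 at
    corner k.  The shift leaves room for the value 0 of the missing corner
    below corner 0, so that corner 0 needs no separate equation. *)
Definition corner_val a b k := (corner_state a b k).1.1.

Lemma corner_valS a b k :
  corner_val a b k.+3 =
  x ^+ h.-1 * (x * corner_val a b k.+1 - corner_val a b k).
Proof. by rewrite /corner_val /=; case: (corner_state a b k) => [[u v] w]. Qed.

(** The value that the equation at corner q forces on the first vertex of the
    upward path leaving it; when there is no such path, the value of
    (x - A) v there. *)
Definition residue a b q := x * corner_val a b q.+1 - corner_val a b q.

(** Along a path, each equation multiplies the value by x. *)
Definition vertex_val a b i : R :=
  match i with
  | 0 => b
  | 1 => a
  | t.+2 => x ^+ (t %% h) * residue a b (t %/ h)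
  end.

Lemma vertex_val_corner a b k :
  vertex_val a b (corner h k) = corner_val a b k.+1.
Proof.
case: k => [|[|k]] //; rewrite corner_valS -/(residue a b k).
have -> : corner h k.+2 = (k * h + h.-1).+2 by rewrite /corner mulSn; lia.
rewrite /vertex_val modnMDl divnMDl //.
by rewrite modn_small ?divn_small ?addn0 // prednK.
Qed.

Lemma residueS a b q :
  residue a b q.+3 = x ^+ h * residue a b q.+1 - x ^+ h.-1 * residue a b q.
Proof.
rewrite {1}/residue !corner_valS -!/(residue _ _ _).
by case: h h_gt0 => [//|h'] _ /=; rewrite exprS mulrA.
Qed.

Definition char_entry (r u v : nat) : R :=
  x * (u == v)%:R - (Gamma_edge h.+2 r u.+1 v.+1)%:R.

Lemma sum_ascent r (F : nat -> R) i : (i < 2 + r * h)%N ->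
  \sum_(w < 2 + r * h)
    ((1 < w)%N && (row_source h r i == row_source h r w))%:R * F w
  = if (1 < i)%N then F i else 0.
Proof.
move=> iN; rewrite (bigD1 (Ordinal iN)) //= eqxx andbT big1 ?addr0; last first.
  move=> w wi; rewrite (inj_in_eq (row_source_inj h_gt0)) ?inE //.
  by rewrite -val_eqE /= eq_sym in wi; rewrite (negPf wi) andbF mul0r.
by case: ifP; rewrite ?mul1r ?mul0r.
Qed.

Lemma sum_edge r (F : nat -> R) i : (0 < r)%N -> (i < 2 + r * h)%N ->
  \sum_(w < 2 + r * h) (Gamma_edge h.+2 r (row_source h r i).+1 w.+1)%:R * F w
  = (if (1 < i)%N then F i else 0)
  + \sum_(w < 2 + r * h) (descent h r (row_source h r i) w)%:R * F w.
Proof.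
move=> r0 iN; rewrite -(sum_ascent F iN) -big_split /=; apply: eq_bigr => w _.
rewrite Gamma_edge_split // -mulrDl; congr (_ * _).
have := ascent_not_descent r (row_source h r i) w h_gt0.
by case: ((1 < w)%N && _); case: descent; rewrite ?addr0 ?add0r.
Qed.

Lemma corner_lt r k : (k < r.+2)%N -> (corner h k < 2 + r * h)%N.
Proof. by case: k => [|[|k]] //= kr; rewrite !ltnS leq_mul2r; lia. Qed.

Lemma sum_eq1 N (F : nat -> R) i : (i < N)%N ->
  \sum_(w < N) (w == i :> nat)%:R * F w = F i.
Proof.
move=> iN; rewrite (bigD1 (Ordinal iN)) //= eqxx mul1r big1 ?addr0 // => w.
by rewrite -val_eqE /= => /negPf->; rewrite mul0r.
Qed.

Lemma residue_corner r a b q : (q < r.+2)%N ->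
  x * vertex_val a b (corner h q) -
   \sum_(w < 2 + r * h) (descent h r (corner h q) w)%:R * vertex_val a b w
   = residue a b q.
Proof.
move=> qr; rewrite vertex_val_corner; congr (_ - _).
case: q qr => [|k] kr.
  by apply: big1 => w _; rewrite descent_corner0 // mul0r.
rewrite -vertex_val_corner -(@sum_eq1 (2 + r * h) (vertex_val a b)).
  by apply: eq_bigr => w _; rewrite descent_corner.
by apply: corner_lt; lia.
Qed.

(** Only the rows of the last two corners, which have no upward edge to absorb
    the residue, are left as constraints on the first two coordinates. *)
Lemma char_entry_vertex_val r a b i : (0 < r)%N -> (i < 2 + r * h)%N ->
  \sum_(w < 2 + r * h) char_entry r (row_source h r i) w * vertex_val a b w =
  if (i < 2)%N then residue a b (r + i) else 0.
Proof.
move=> r0 iN; rewrite /char_entry.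
under eq_bigr => w _ do rewrite mulrBl -mulrA [_ == _]eq_sym.
rewrite sumrB -mulr_sumr sum_eq1; last first.
  case: i iN => [|[|t]] iN; rewrite /row_source; try exact: corner_lt.
  case: ifP => _; last by lia.
  have : (t %/ h < r)%N by rewrite ltn_divLR //; lia.
  by move=> tr; apply: corner_lt; lia.
rewrite sum_edge //; case: i iN => [|[|t]] iN.
- by rewrite add0r residue_corner // addn0.
- by rewrite add0r residue_corner // addn1.
(* The upward edge ends at t.+2 itself; the other terms must add up to the
   value there. *)
rewrite /row_source opprD addrCA addrC; case: ifPn => ht.
  have tr : (t %/ h < r)%N by rewrite ltn_divLR //; lia.
  rewrite residue_corner; last by lia.
  by rewrite /= (eqP ht) mul1r subrr.
rewrite big1 ?subr0; last by move=> w _; rewrite descent_interior // mul0r.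
case: t ht {iN} => [|t] ht; first by rewrite dvdn0 in ht.
by rewrite /vertex_val modnS divnS // (negPf ht) add0n exprS mulrA subrr.
Qed.

Definition char_mx_rows r : 'M[R]_(2 + r * h) :=
  \matrix_(i, j) char_entry r (row_source h r i) j.

(** The solutions whose first two coordinates are (1, 0) and (0, 1). *)
Definition solution (j : 'I_2) : nat -> R :=
  vertex_val (j == 1)%:R (j == 0)%:R.

Definition corner_residues r : 'M[R]_2 :=
  \matrix_(i, j) residue (j == 1)%:R (j == 0)%:R (r + i).

(** A unitriangular matrix carrying the two basic solutions as its first two
    columns: multiplying by it is the column operation that eliminates the
    first two variables. *)
Definition elim_mx r : 'M[R]_(2 + r * h) :=
  block_mx 1%:M 0 (\matrix_(i, j) solution j i.+2) 1%:M.

Lemma mul_char_mx_rows_elim r : (0 < r)%N ->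
  char_mx_rows r *m elim_mx r =
  block_mx (corner_residues r) (ursubmx (char_mx_rows r))
           0 (drsubmx (char_mx_rows r)).
Proof.
move=> r0.
have lE : lsubmx (elim_mx r) = \matrix_(w, j) solution j w.
  apply/matrixP => w j; rewrite !mxE; case: splitP => k kE; rewrite !mxE.
    case: splitP => l /= lE; last by have := ltn_ord j; lia.
    rewrite mxE /solution kE; have -> : l = j by apply: val_inj.
    by case: k {kE} => [[|[|k]]] //= ?; case: j {lE l} => [[|[|l]]] //.
  case: splitP => l /= lE; last by have := ltn_ord j; lia.
  by rewrite mxE kE; have -> : l = j by apply: val_inj.
rewrite -[elim_mx r]hsubmxK mul_mx_row lE.
have -> : rsubmx (elim_mx r) = col_mx 0 1%:M.
  by rewrite /elim_mx block_mxEh row_mxKr.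
rewrite -{2}[char_mx_rows r]submxK mul_block_col !mulmx0 !mulmx1 !add0r.
rewrite block_mxEh; congr row_mx.
apply/matrixP => i j; rewrite !mxE.
under eq_bigr => w _ do rewrite !mxE.
by rewrite char_entry_vertex_val //; case: splitP => k kE; rewrite !mxE ?kE.
Qed.

Lemma row_source_lt r t : (row_source h r t.+2 < t.+2)%N.
Proof.
rewrite /row_source; case: ifPn => [/divnK|_]; last by lia.
by case: (t %/ h)%N => [|[|q]] //=; nia.
Qed.

Lemma descent_row_source_lt r t v :
  descent h r (row_source h r t.+2) v -> (v < t.+2)%N.
Proof.
rewrite /row_source; case: ifPn => [/divnK tE|ht]; last first.
  by rewrite descent_interior.
case/hasP => k _ /andP[/eqP/(corner_inj h_gt0) qE /eqP->].
rewrite qE in tE; rewrite -tE; case: k {qE tE} => [|[|k]] //=.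
by rewrite !ltnS leq_mul2r; lia.
Qed.

(** In the row indexed by i >= 2, the diagonal entry -1 comes from the upward
    edge into i, and the other entries, at the source of this edge and possibly
    at the corner below that source, lie to the left. *)
Lemma det_drsubmx_char_mx_rows r : (0 < r)%N ->
  \det (drsubmx (char_mx_rows r)) = (-1) ^+ (r * h).
Proof.
move=> r0.
have E (i j : 'I_(r * h)) : (i <= j)%N ->
    drsubmx (char_mx_rows r) i j = - (i == j)%:R.
  move=> ij; rewrite !mxE /char_entry Gamma_edge_split ?ltn_ord //.
  have lt_s := row_source_lt r i.
  rewrite (inj_in_eq (row_source_inj h_gt0)) ?inE ?ltn_ord //.
  have sE (k : 'I_(r * h)) : rshift 2 k = k.+2 :> nat by [].
  rewrite !sE ltn_eqF ?mulr0 ?sub0r; last by lia.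
  case: (boolP (descent _ _ _ _)) => [/descent_row_source_lt|_]; first by lia.
  by rewrite orbF !eqSS.
rewrite det_trig; last first.
  apply/is_trig_mxP => i j ij; rewrite E 1?ltnW //.
  by rewrite -val_eqE /= ltn_eqF ?oppr0.
under eq_bigr => i _ do rewrite E // eqxx.
by rewrite prodr_const card_ord.
Qed.

Lemma det_char_mx_rows r : (0 < r)%N ->
  \det (char_mx_rows r) = (-1) ^+ (r * h) * \det (corner_residues r).
Proof.
move=> r0; have := congr1 determinant (mul_char_mx_rows_elim r0).
rewrite det_mulmx det_lblock !det1 !mulr1 => ->.
by rewrite det_ublock det_drsubmx_char_mx_rows // mulrC.
Qed.

(** * The recursion on the number of cycles *)

Fixpoint chain_state (r : nat) : R * R * R :=
  if r is r'.+1 then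
    let: (u, v, w) := chain_state r' in
    (v, w, x ^+ h * w - (x ^+ h.-1) ^+ 2 * u)
  else (x ^+ 2, x ^+ h.+2 - 1, x ^+ h * (x ^+ h.+2 - 2)).

(** The characteristic polynomial of the chain of r cycles: the last cycle is
    either avoided, leaving h dangling vertices on a chain of r - 1 cycles, or
    used, which cuts the chain three cycles earlier and leaves 2h - 2 dangling
    vertices.  For r = 0 the chain is the single edge between the first two
    vertices. *)
Definition chain_poly r := (chain_state r).1.1.

Lemma chain_polyS r :
  chain_poly r.+3 = x ^+ h * chain_poly r.+2 - (x ^+ h.-1) ^+ 2 * chain_poly r.
Proof. by rewrite /chain_poly /=; case: (chain_state r) => [[u v] w]. Qed.

(** Write [i, j] for the 2 x 2 minor of residues with indices i and j, and
    a = x^h, b = x^(h-1).  By [residueS], [r+3, r+4] expands into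
    - a [r+2, r+3] + b [r+1, r+3], and expanding [r+1, r+3] in turn leaves only
    b [r, r+1]. *)
Lemma det_corner_residues r :
  \det (corner_residues r) = (-1) ^+ r.+1 * chain_poly r.
Proof.
have dE q : \det (corner_residues q) =
    residue 0 1 q * residue 1 0 q.+1 - residue 1 0 q * residue 0 1 q.+1.
  by rewrite det_mx2 !mxE /= addn0 addn1.
have xh : x ^+ h = x * x ^+ h.-1 by rewrite -exprS prednK.
have xh2 : x ^+ h.+2 = x ^+ 2 * x ^+ h by rewrite -exprD.
elim/ltn_ind: r => -[|[|[|r]]] IH; rewrite dE.
- by rewrite /residue /corner_val /chain_poly /=; ring.
- by rewrite /residue /corner_val /chain_poly /= xh2 xh; ring.
- by rewrite /residue /corner_val /chain_poly /= xh2 xh; ring.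
rewrite chain_polyS [residue 0 1 r.+4]residueS [residue 1 0 r.+4]residueS.
have E0 := IH r (ltnW (ltnW (ltnSn _))); have := IH r.+2 (ltnSn _).
move: E0; rewrite !dE.
rewrite [residue 0 1 r.+3]residueS [residue 1 0 r.+3]residueS.
set a0 := residue 0 1 r; set a1 := residue 0 1 r.+1; set a2 := residue 0 1 r.+2.
set b0 := residue 1 0 r; set b1 := residue 1 0 r.+1; set b2 := residue 1 0 r.+2.
move: a0 a1 a2 b0 b1 b2 => a0 a1 a2 b0 b1 b2.
move: (chain_poly r) (chain_poly r.+2) => d0 d2.
rewrite !exprS; move: (_ ^+ r) => s E0 E2.
move: (x ^+ h) (x ^+ h.-1) E2 => a b E2.
transitivity (- a * (a2 * (a * b1 - b * b0) - b2 * (a * a1 - b * a0)) +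
              b ^+ 2 * (a0 * b1 - b0 * a1)); first by ring.
by rewrite E0 E2; ring.
Qed.

End Elimination.

(** The row permutation makes the sign depend on r and h; it is left
    undetermined because it affects neither the degree nor the order at 0. *)
Lemma det_char_entry (R : comNzRingType) (x : R) (h r : nat) :
  (0 < h)%N -> (0 < r)%N ->
  exists b : bool,
    \det (\matrix_(u < 2 + r * h, v < 2 + r * h) char_entry x h r u v)
    = (-1) ^+ b * chain_poly x h r.
Proof.
move=> h0 r0; set M := \matrix_(u, v) _.
have gN (i : 'I_(2 + r * h)) : (row_source h r i < 2 + r * h)%N.
  case: i => i iN; rewrite [nat_of_ord _]/=.
  case: i iN => [|[|t]] tN; try by apply: corner_lt; lia.
  by have := row_source_lt h0 r t; lia.
have gI : injective (fun i => Ordinal (gN i)).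
  move=> i j /(congr1 val)/= /(row_source_inj h0) ij.
  by apply: val_inj; apply: ij; rewrite inE.
have PE : char_mx_rows x h r = row_perm (perm gI) M.
  by apply/matrixP => i j; rewrite !mxE permE.
have := det_char_mx_rows x h0 r0; rewrite PE row_permE det_mulmx det_perm.
rewrite det_corner_residues // mulrA -exprD => dE.
exists (odd (r * h + r.+1) (+) perm gI).
by rewrite signr_addb signr_odd -mulrAC -dE mulrAC -signr_addb addbb mul1r.
Qed.

Lemma Gamma_orderE h r : Gamma_order h.+2 r = (2 + r * h)%N.
Proof. by rewrite /Gamma_order !mulnS; lia. Qed.

Lemma Phi_chain_poly h r : (0 < h)%N -> (0 < r)%N ->
  exists b : bool, Phi h.+2 r = (-1) ^+ b * chain_poly 'X h r.
Proof.
move=> h0 r0; have [b bE] := det_char_entry ('X : {poly int}) h0 r0; exists b.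
rewrite -bE /Phi /adjacency; move: (Gamma_order _ _) (Gamma_orderE h r) => N ->.
rewrite /char_poly; congr (\det _); apply/matrixP => u v.
by rewrite !mxE /char_entry mulr_natr polyC_natr.
Qed.

(** * The order at 0 *)

(** The maximal number of disjoint cycles is m + 1 for r = 3m + 1, 3m + 2 and
    3m + 3.  The induction carries the sign (-1)^(m+1) of the constant terms and
    not merely that they are nonzero, since in the recursion it is the equality
    of the signs that prevents a cancellation. *)
Lemma chain_poly_factor h m : (0 < h)%N ->
  let e := (m * h.-1.*2)%N in
  exists C1 C2 C3 : {poly int},
  [/\ chain_poly 'X h (3 * m + 1) = 'X^e * C1,
      chain_poly 'X h (3 * m + 2) = 'X^(e + h) * C2 &
      chain_poly 'X h (3 * m + 3) = 'X^(e + h.*2) * C3] /\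
  [/\ (-1) ^+ m * C1.[0] < 0, (-1) ^+ m * C2.[0] < 0
     & (-1) ^+ m * C3.[0] < 0].
Proof.
move=> h0 e.
have Xh : 'X^h = 'X * 'X^(h.-1) :> {poly int} by rewrite -exprS prednK.
have Xh2 : 'X^(h.*2) = ('X * 'X^(h.-1)) ^+ 2 :> {poly int}.
  by rewrite -Xh -exprM muln2.
rewrite {}/e; elim: m => [|m [C1 [C2 [C3]]]].
  exists ('X^(h.+2) - 1), ('X^(h.+2) - 2), ('X^(h.+2) - 3); split; split.
  - by rewrite mul1r.
  - by [].
  - rewrite muln0 mul0n !add0n (chain_polyS _ _ 0) Xh2 /chain_poly /= !exprS Xh.
    by ring.
1-3: by rewrite expr0 mul1r !hornerE expr0n.
set e := (m * h.-1.*2)%N => -[[E1 E2 E3] [s1 s2 s3]].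
have -> : (m.+1 * h.-1.*2 = e + h.-1 * 2)%N by rewrite mulSn addnC muln2.
(* Only here does m change: the term from C3 gains the factor x^(h+2), so the
   constant term comes from C1 alone. *)
pose D := 'X^(h.+2) * C3 - C1.
exists D, (D - C2), (D - C2 - C3).
have R1 : chain_poly 'X h (3 * m.+1 + 1) = 'X^(e + h.-1 * 2) * D.
  rewrite mulnS (_ : 3 + 3 * m + 1 = (3 * m + 1).+3)%N; last by lia.
  rewrite chain_polyS -addn2 -addnA E1 E3 !exprD exprM Xh2 /D !exprS Xh.
  by ring.
have R2 : chain_poly 'X h (3 * m.+1 + 2) = 'X^(e + h.-1 * 2 + h) * (D - C2).
  rewrite mulnS (_ : 3 + 3 * m + 2 = (3 * m + 2).+3)%N; last by lia.
  rewrite chain_polyS (_ : (3 * m + 2).+2 = 3 * m.+1 + 1)%N; last by lia.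
  by rewrite R1 E2 !exprD exprM Xh; ring.
have R3 : chain_poly 'X h (3 * m.+1 + 3) =
    'X^(e + h.-1 * 2 + h.*2) * (D - C2 - C3).
  rewrite mulnS (_ : 3 + 3 * m + 3 = (3 * m + 3).+3)%N; last by lia.
  rewrite chain_polyS (_ : (3 * m + 3).+2 = 3 * m.+1 + 2)%N; last by lia.
  by rewrite R2 E3 !exprD exprM Xh2 Xh; ring.
split; first by split.
have C10 : D.[0] = - C1.[0] by rewrite !hornerE exprS mul0r mul0r sub0r.
clearbody D; rewrite !hornerE C10 exprS; move: s1 s2 s3.
move: ((-1) ^+ m) (C1.[0]) (C2.[0]) (C3.[0]) => s a b c.
by split; lia.
Qed.

Lemma chain_poly_ord h r : (0 < h)%N -> (0 < r)%N ->
  exists e (c : {poly int}), [/\ c.[0] != 0, chain_poly 'X h r = 'X^e * c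
    & (e + h.+2 * ((r + 2) %/ 3) = 2 + r * h)%N].
Proof.
move=> h0; case: r => // r _.
have [C1 [C2 [C3 [[E1 E2 E3] [s1 s2 s3]]]]] := chain_poly_factor (r %/ 3) h0.
have nz (c : {poly int}) : (-1) ^+ (r %/ 3) * c.[0] < 0 -> c.[0] != 0.
  by apply: contraTneq => ->; rewrite mulr0 ltxx.
have -> : ((r.+1 + 2) %/ 3 = (r %/ 3).+1)%N by lia.
move: E1 E2 E3 s1 s2 s3; have := divn_eq r 3.
set m := (r %/ 3)%N; have := ltn_pmod r (isT : 0 < 3)%N.
case: (r %% 3)%N => [|[|[|//]]] _ -> E1 E2 E3 s1 s2 s3.
- exists (m * h.-1.*2)%N, C1; split; first exact: nz.
    by rewrite -E1; congr chain_poly; lia.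
  by case: h h0 {E1 E2 E3} => // h _ /=; rewrite -muln2; lia.
- exists (m * h.-1.*2 + h)%N, C2; split; first exact: nz.
    by rewrite -E2; congr chain_poly; lia.
  by case: h h0 {E1 E2 E3} => // h _ /=; rewrite -muln2; lia.
- exists (m * h.-1.*2 + h.*2)%N, C3; split; first exact: nz.
    by rewrite -E3; congr chain_poly; lia.
  by case: h h0 {E1 E2 E3} => // h _ /=; rewrite -!muln2; lia.
Qed.

(** * Counting eigenvalues *)

Lemma mup0_MXn (F : fieldType) e (c : {poly F}) :
  c.[0] != 0 -> mup 0 ('X^e * c) = e.
Proof.
by move=> c0; rewrite mupMl // -['X]subr0 -polyC0 mup_XsubCX eqxx.
Qed.

Lemma ordx_MXn e (c : {poly int}) : c.[0] != 0 -> ordx ('X^e * c) = e.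
Proof.
move=> c0; rewrite /ordx rmorphM /= map_polyXn mup0_MXn //.
by rewrite -(rmorph0 intr) horner_map intr_eq0.
Qed.

Lemma num_nonzero_eigenvaluesE N (A : 'M[int]_N) e (c : {poly int}) :
  c.[0] != 0 -> char_poly A = 'X^e * c -> num_nonzero_eigenvalues A = (N - e)%N.
Proof.
move=> c0 AE; rewrite /num_nonzero_eigenvalues /eigenvalues.
case: closed_field_poly_normal => s /=.
rewrite (monicP (char_poly_monic _)) scale1r => sE.
have := count_predC (pred1 0) s; rewrite -mu_prod_XsubC -sE -map_char_poly AE.
rewrite rmorphM /= map_polyXn mup0_MXn; last first.
  by rewrite -(rmorph0 intr) horner_map intr_eq0.
have := size_prod_XsubC s id; rewrite -sE size_char_poly => -[->] <-.
by rewrite addKn; apply: eq_count => z.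
Qed.

Theorem corollary4p3 (n r : nat) (hn : (3 <= n)%N) (hr : (1 <= r)%N) :
  num_nonzero_eigenvalues (adjacency n r) = (deg (Phi n r) - ordx (Phi n r))%N
  /\ (deg (Phi n r) - ordx (Phi n r))%N = (n * ((r + 2) %/ 3))%N.
Proof.
have [h h0 nE] : exists2 h, (0 < h)%N & n = h.+2 by exists (n - 2)%N; lia.
rewrite {n hn}nE.
have [b PhiE] := Phi_chain_poly h0 hr.
have [e [c [c0 cE eE]]] := chain_poly_ord h0 hr.
have E : Phi h.+2 r = 'X^e * ((-1) ^+ b * c) by rewrite PhiE cE mulrCA.
have d0 : ((-1) ^+ b * c).[0] != 0.
  by rewrite -polyCN -polyC_exp hornerCM mulf_neq0 // signr_eq0.
have dE : deg (Phi h.+2 r) = Gamma_order h.+2 r by rewrite /deg size_char_poly.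
rewrite (num_nonzero_eigenvaluesE d0 E) dE E ordx_MXn //; split=> //.
by rewrite Gamma_orderE -eE addKn.
Qed.
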